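(* Let $G$ and $H$ be non-trivial groups that are FIG, and let $H$ act faithfully on a set $X$. Then $G\wr_X H$ is either FIG or IG. Moreover, $G\wr_X H$ is FIG if and only if it is finitely generated. In particular, the regular wreath product $G\wr H$ is FIG.
   Context: A subset $S$ of a group $K$ invariably generates $K$ if for every choice of elements $a_s\in K$ ($s\in S$) one has $\langle a_s^{-1}sa_s : s\in S\rangle=K$. A group is FIG (finitely invariably generated) if it has a finite invariable generating set. A group is IG if it has an invariable generating set but no finite one (so IG excludes FIG). For non-trivial groups $G,H$ with $H$ acting faithfully (on the right) on a set $X$, the (restricted) wreath product is $G\wr_X H=\left(\bigoplus_{x\in X}G_x\right)\rtimes H$, where each $G_x$ is a copy of $G$, $g^{(x)}$ denotes the element $g\in G$ in $G_x$, and $h^{-1}g^{(x)}h=g^{(xh)}$ for $h\in H$. The regular wreath product $G\wr H$ is the case $X=H$ with $H$ acting on itself by right multiplication. *)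

(* Defs.v *)
From HB Require Import structures.
From mathcomp Require Import all_boot finmap.
From mathcomp Require Import boolp classical_sets functions cardinality.

Set Implicit Arguments.
Unset Strict Implicit.
Unset Printing Implicit Defensive.

Local Open Scope group_scope.
Local Open Scope classical_set_scope.

Section Generation.
Variable K : groupType.
Implicit Types (A S : set K).

Definition nontrivial_group : Prop := exists x : K, x <> 1.

Definition is_subgroup A : Prop := group_closed (mem A).

Lemma is_subgroupP A :
  is_subgroup A <-> A 1 /\ (forall x y, A x -> A y -> A (x * y^-1)).
Proof.
split=> [[/set_mem A1 AV]|[A1 AV]].
  split=> // x y Ax Ay; apply/set_mem.
  by apply: (AV x y); apply/mem_set.
by split=> [|x y /set_mem Ax /set_mem Ay]; apply/mem_set => //; apply: AV.
Qed.

(* [smallest] is the intersection of all subgroups containing [A]. *)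
Definition generated A : set K := smallest is_subgroup A.

Lemma sub_generated A : A `<=` generated A.
Proof. exact: sub_smallest. Qed.

Lemma generated_subgroup A : is_subgroup (generated A).
Proof.
apply/is_subgroupP; split=> [B [/is_subgroupP[]]//|x y Ax Ay B [sB AB]].
have [_ BV] := (is_subgroupP B).1 sB.
by apply: BV; [apply: Ax | apply: Ay].
Qed.

Definition generates S : Prop := generated S = [set: K].

(* [s ^ a] is the conjugate a^-1 * (s * a); only the values of [a] on [S]
   matter, so the total [a] is a choice of one conjugator for each s in S. *)
Definition invariably_generates S : Prop :=
  forall a : K -> K, generates [set s ^ a s | s in S].

Definition finitely_generated : Prop :=
  exists S, finite_set S /\ generates S.

Definition FIG : Prop :=
  exists S, finite_set S /\ invariably_generates S.

Definition IG : Prop :=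
  (exists S, invariably_generates S) /\
  ~ (exists S, finite_set S /\ invariably_generates S).

End Generation.

Arguments nontrivial_group : clear implicits.
Arguments finitely_generated : clear implicits.
Arguments FIG : clear implicits.
Arguments IG : clear implicits.

Record right_action (H : groupType) (X : Type) := RightAction {
  act_fun :> X -> H -> X;
  act1 : forall x, act_fun x 1 = x;
  actM : forall x h k, act_fun x (h * k) = act_fun (act_fun x h) k
}.

Definition faithful_action (H : groupType) (X : Type)
    (to : right_action H X) : Prop :=
  forall h, (forall x, to x h = x) -> h = 1.

Definition regular_action (H : groupType) : right_action H H :=
  @RightAction H H (fun x h => x * h) (@mulg1 H) (@mulgA H).

Definition direct_sum (X : choiceType) (G : groupType) : Type :=
  {fsfun X -> G with 1}.

Section DirectSum.
Variables (X : choiceType) (G : groupType).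
Local Notation B := (direct_sum X G).
Implicit Types (f g : B).

HB.instance Definition _ := Choice.copy B {fsfun X -> G with 1}.

Lemma ds_ext f g : f =1 g -> f = g.
Proof. by move/fsfunP. Qed.

Definition ds_one : B := [fsfun for (fun=> 1)].
Definition ds_mul f g : B :=
  [fsfun x in (finsupp f `|` finsupp g)%fset => f x * g x | 1].
Definition ds_inv f : B := [fsfun x in finsupp f => (f x)^-1 | 1].

Lemma ds_dflt f x : x \notin finsupp f -> f x = 1.
Proof. exact: fsfun_dflt. Qed.

Lemma ds_one_fun x : ds_one x = 1.
Proof. by rewrite fsfunE. Qed.

Lemma ds_mul_fun f g x : ds_mul f g x = f x * g x.
Proof.
rewrite fsfun_fun inE; case: ifP => // /negbT.
by rewrite negb_or => /andP[/ds_dflt -> /ds_dflt ->]; rewrite mulg1.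
Qed.

Lemma ds_inv_fun f x : ds_inv f x = (f x)^-1.
Proof.
rewrite fsfun_fun; case: ifP => // /negbT /ds_dflt ->.
by rewrite invg1.
Qed.

Fact ds_mulA : associative ds_mul.
Proof. by move=> f g k; apply: ds_ext => x; rewrite !ds_mul_fun mulgA. Qed.
Fact ds_mul1 : left_id ds_one ds_mul.
Proof. by move=> f; apply: ds_ext => x; rewrite ds_mul_fun ds_one_fun mul1g. Qed.
Fact ds_mulr1 : right_id ds_one ds_mul.
Proof. by move=> f; apply: ds_ext => x; rewrite ds_mul_fun ds_one_fun mulg1. Qed.
Fact ds_mulV : left_inverse ds_one ds_inv ds_mul.
Proof.
move=> f; apply: ds_ext => x.
by rewrite ds_mul_fun ds_inv_fun ds_one_fun mulVg.
Qed.
Fact ds_mulrV : right_inverse ds_one ds_inv ds_mul.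
Proof.
move=> f; apply: ds_ext => x.
by rewrite ds_mul_fun ds_inv_fun ds_one_fun mulgV.
Qed.

HB.instance Definition _ :=
  isGroup.Build B ds_mulA ds_mul1 ds_mulr1 ds_mulV ds_mulrV.

Lemma ds1E x : (1 : B) x = 1. Proof. exact: ds_one_fun. Qed.
Lemma dsME f g x : (f * g) x = f x * g x. Proof. exact: ds_mul_fun. Qed.
Lemma dsVE f x : f^-1 x = (f x)^-1. Proof. exact: ds_inv_fun. Qed.

(* The element g^{(x)}. *)
Definition ds_single (c : G) (x : X) : B := [fsfun y in [fset x]%fset => c | 1].

Lemma ds_singleE (c : G) x y : ds_single c x y = if y == x then c else 1.
Proof. by rewrite fsfun_fun inE. Qed.

End DirectSum.

(* [Wreath f h] is the product f h of f in the direct sum and h in H.  The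
   parameter [to] is phantom here; the group law below depends on it. *)
Record wreath (G H : groupType) (X : choiceType) (to : right_action H X) :=
  Wreath { wr_base : direct_sum X G; wr_top : H }.

Arguments wreath G {H X} to.
Arguments Wreath {G H X to} wr_base wr_top.

Section Wreath.
Variables (G H : groupType) (X : choiceType) (to : right_action H X).
Local Notation B := (direct_sum X G).
Implicit Types (f g : B) (h k : H).

(* h f h^-1 in the wreath product: since h g^{(x)} h^-1 = g^{(x h^-1)}, its
   coordinate at x is the coordinate of f at x h. *)
Definition ds_shift h f : B :=
  [fsfun x in [fset to y h^-1 | y in finsupp f]%fset => f (to x h) | 1].

Lemma actK h x : to (to x h) h^-1 = x.
Proof. by rewrite -actM mulgV act1. Qed.
Lemma actKV h x : to (to x h^-1) h = x.
Proof. by rewrite -actM mulVg act1. Qed.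

Lemma ds_shiftE h f x : ds_shift h f x = f (to x h).
Proof.
rewrite fsfun_fun; case: ifP => // /negbT xN.
apply/esym/ds_dflt; apply: contra xN => xS; apply/imfsetP.
by exists (to x h) => //; rewrite actK.
Qed.

Lemma ds_shift1 f : ds_shift 1 f = f.
Proof. by apply: ds_ext => x; rewrite ds_shiftE act1. Qed.
Lemma ds_shiftM h k f : ds_shift (h * k) f = ds_shift h (ds_shift k f).
Proof. by apply: ds_ext => x; rewrite !ds_shiftE actM. Qed.
Lemma ds_shift_mul h f g : ds_shift h (f * g) = ds_shift h f * ds_shift h g.
Proof. by apply: ds_ext => x; rewrite !(ds_shiftE, dsME). Qed.
Lemma ds_shift_one h : ds_shift h 1 = 1.
Proof. by apply: ds_ext => x; rewrite ds_shiftE !ds1E. Qed.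

Local Notation wreath := (wreath G to).

Definition wreath_pair (w : wreath) : B * H := (wr_base w, wr_top w).
Definition pair_wreath (p : B * H) : wreath := Wreath p.1 p.2.
Fact wreath_pairK : cancel wreath_pair pair_wreath. Proof. by case. Qed.
HB.instance Definition _ := Choice.copy wreath (can_type wreath_pairK).

(* f h f' h' = f (h f' h^-1) h h' *)
Definition wr_mul (v w : wreath) : wreath :=
  Wreath (wr_base v * ds_shift (wr_top v) (wr_base w)) (wr_top v * wr_top w).
Definition wr_one : wreath := Wreath 1 1.
Definition wr_inv (w : wreath) : wreath :=
  Wreath (ds_shift (wr_top w)^-1 (wr_base w)^-1) (wr_top w)^-1.

Fact wr_mulA : associative wr_mul.
Proof.
case=> [f h] [f' h'] [f'' h'']; rewrite /wr_mul /=.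
by rewrite ds_shift_mul ds_shiftM !mulgA.
Qed.
Fact wr_mul1 : left_id wr_one wr_mul.
Proof. by case=> f h; rewrite /wr_mul /= ds_shift1 !mul1g. Qed.
Fact wr_mulr1 : right_id wr_one wr_mul.
Proof. by case=> f h; rewrite /wr_mul /= ds_shift_one !mulg1. Qed.
Fact wr_mulV : left_inverse wr_one wr_inv wr_mul.
Proof.
by case=> f h; rewrite /wr_mul /wr_inv /= -ds_shift_mul !mulVg ds_shift_one.
Qed.
Fact wr_mulrV : right_inverse wr_one wr_inv wr_mul.
Proof.
case=> f h; rewrite /wr_mul /wr_inv /= -ds_shiftM !mulgV ds_shift1.
by rewrite mulgV.
Qed.

HB.instance Definition _ :=
  isGroup.Build wreath wr_mulA wr_mul1 wr_mulr1 wr_mulV wr_mulrV.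

Lemma wrME (v w : wreath) : v * w = wr_mul v w. Proof. by []. Qed.
Lemma wrVE (w : wreath) : w^-1 = wr_inv w. Proof. by []. Qed.

Definition wr_in_base (f : B) : wreath := Wreath f 1.
Definition wr_in_top (h : H) : wreath := Wreath 1 h.

Lemma wr_in_baseM f g : wr_in_base (f * g) = wr_in_base f * wr_in_base g.
Proof. by rewrite wrME /wr_mul /= ds_shift1 mulg1. Qed.

Lemma wr_in_topM h k : wr_in_top (h * k) = wr_in_top h * wr_in_top k.
Proof. by rewrite wrME /wr_mul /= ds_shift_one mulg1. Qed.

Lemma wr_decomp f h : Wreath f h = wr_in_base f * wr_in_top h.
Proof. by rewrite wrME /wr_mul /= ds_shift1 mulg1 mul1g. Qed.

(* h^-1 g^{(x)} h = g^{(x h)} *)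
Lemma wr_conj (c : G) x h :
  (wr_in_top h)^-1 * wr_in_base (ds_single c x) * wr_in_top h =
  wr_in_base (ds_single c (to x h)).
Proof.
have -> : (wr_in_top h)^-1 = wr_in_top h^-1.
  by rewrite wrVE /wr_inv /= invg1 ds_shift_one.
rewrite !wrME /wr_mul /= ds_shift_one mul1g !mulg1 mulVg.
congr Wreath; apply: ds_ext => y; rewrite ds_shiftE !ds_singleE.
congr (if _ then _ else _).
by apply/eqP/eqP => [<-|->]; rewrite ?actKV ?actK.
Qed.

End Wreath.

Arguments wr_in_base {G H X} to f.
Arguments wr_in_top G {H X} to h.

Definition regular_wreath (G H : groupType) : groupType :=
  wreath G (regular_action H).

(* Main.v *)
Require Import Defs.
From mathcomp Require Import all_boot finmap.
From mathcomp Require Import boolp classical_sets functions cardinality.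

(** Let [W] be the wreath product, with base group [B] (the direct sum of copies
    of [G] indexed by [X]).  Let [S] and [T] invariably generate [G] and [H],
    and let [C] be a subset of [X] meeting every [H]-orbit.  The copies of the
    elements of [S] at the points of [C], together with [T], invariably generate
    [W].  For let [L] be the subgroup generated by arbitrary conjugates of these
    elements.

    - [L] maps onto [H], since its image contains a conjugate of each element
      of [T] ([top_onto]).
    - A conjugate of [s] at [x] is a conjugate of [s] at some point [x h].  An
      element of [L] lying over [h^-1] brings it back to a conjugate of [s] at
      [x].  As [S] invariably generates [G], [L] contains the whole copy of [G]
      at [x], for each [x] in [C] ([fiber_on_transversal]).
    - Conjugation by elements of [L] over all of [H] spreads this to every point
      of the orbits of [C], so [L] contains [B]; as it maps onto [H], it is [W]
      ([wreath_gens_invariable]).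

    Taking [C] to be all of [X] shows that [W] always has an invariable
    generating set, so it is FIG or IG.  If [C] is finite, so is the generating
    set.  A finite [C] exists when [X] is a single orbit, as in the regular
    case, and also when [W] is finitely generated: the supports of the base
    components of finitely many generators involve finitely many points, and the
    elements of [W] supported on the orbits of these points form a subgroup,
    which is then [W] ([fin_gen_transversal]).  Conversely an invariable
    generating set generates, as one sees with trivial conjugators. *)

Local Open Scope group_scope.
Local Open Scope classical_set_scope.

(** * Generation *)

Lemma generates_sub {K : groupType} (S A : set K) :
  generates S -> is_subgroup A -> S `<=` A -> forall x, A x.
Proof.
move=> genS sA SA x.
have : generated S x by rewrite genS.
by apply.
Qed.

Lemma invariably_generates_generates {K : groupType} (S : set K) :
  invariably_generates S -> generates S.
Proof.
move=> /(_ (fun=> 1)); congr generates; apply/seteqP; split=> x.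
  by case=> s Ss <-; rewrite conjg1.
by move=> Sx; exists x => //; rewrite conjg1.
Qed.

Lemma FIG_finitely_generated (K : groupType) : FIG K -> finitely_generated K.
Proof.
by case=> S [finS /invariably_generates_generates genS]; exists S.
Qed.

(** This is how invariable generation gets used below: each conjugator is
    extracted separately from the subgroup, and choice assembles them into the
    function that the definition quantifies over. *)
Lemma invariably_generates_meet {K : groupType} (S A : set K) :
  invariably_generates S -> is_subgroup A ->
  (forall s, S s -> exists c, A (s ^ c)) -> forall x, A x.
Proof.
move=> igS sA meetA.
have /choice[a aP] : forall s, exists c, S s -> A (s ^ c).
  move=> s; have [/meetA[c Ac]|nSs] := pselect (S s); first by exists c.
  by exists 1.
apply: generates_sub (igS a) sA _ => _ [s Ss <-]; exact: aP.
Qed.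

Section Subgroup.
Context {K : groupType} {A : set K}.
Hypothesis sA : is_subgroup A.

Lemma subgroup1 : A 1. Proof. by case/is_subgroupP: sA. Qed.

Lemma subgroupV x : A x -> A x^-1.
Proof.
case/is_subgroupP: sA => A1 AV Ax.
by rewrite -[_^-1]mul1g; apply: AV.
Qed.

Lemma subgroupM x y : A x -> A y -> A (x * y).
Proof.
move=> Ax /subgroupV Ay; case/is_subgroupP: sA => _ AV.
by rewrite -[y]invgK; apply: AV.
Qed.

Lemma subgroupJ x y : A x -> A y -> A (x ^ y).
Proof.
by move=> Ax Ay; apply: subgroupM (subgroupV _ Ay) (subgroupM _ _ Ax Ay).
Qed.

End Subgroup.

(** * Invariable generation of wreath products *)

Section WreathGeneration.
Context {G H : groupType} {X : choiceType} (to : right_action H X).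
Local Notation W := (wreath G to).
Local Notation single g x := (wr_in_base to (ds_single g x)).

Definition orbits_of (C : set X) : set X :=
  [set y | exists x, C x /\ exists h, to x h = y].

Definition meets_orbits (C : set X) : Prop := forall y, orbits_of C y.

Definition wreath_gens (S : set G) (T : set H) (C : set X) : set W :=
  [set single p.1 p.2 | p in S `*` C] `|` wr_in_top G to @` T.

Lemma wreath_gens_finite S T C :
  finite_set S -> finite_set T -> finite_set C -> finite_set (wreath_gens S T C).
Proof.
move=> finS finT finC; rewrite finite_setU; split; apply: finite_image => //.
exact: finite_setX.
Qed.

Lemma wr_topM (v w : W) : wr_top (v * w) = wr_top v * wr_top w.
Proof. by []. Qed.

Lemma wr_topV (w : W) : wr_top w^-1 = (wr_top w)^-1.
Proof. by []. Qed.

Lemma wr_in_base_inv f : wr_in_base to f^-1 = (wr_in_base to f)^-1 :> W.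
Proof. by rewrite wrVE /wr_inv /= invg1 ds_shift1. Qed.

Lemma singleM g k x : single (g * k) x = single g x * single k x :> W.
Proof.
rewrite -wr_in_baseM; congr wr_in_base; apply: ds_ext => y.
by rewrite dsME !ds_singleE; case: ifP => // _; rewrite mulg1.
Qed.

Lemma singleV g x : single g^-1 x = (single g x)^-1 :> W.
Proof.
rewrite -wr_in_base_inv; congr wr_in_base; apply: ds_ext => y.
by rewrite dsVE !ds_singleE; case: ifP => // _; rewrite invg1.
Qed.

Lemma single1 x : single 1 x = 1 :> W.
Proof. by rewrite -(mulgV (1 : G)) singleM singleV mulgV. Qed.

(** Conjugation moves the copy at [x] to the copy at [x h], up to an inner
    automorphism of [G]; invariable generation of [G] absorbs the latter. *)
Lemma single_conj g x (w : W) :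
  single g x ^ w = single (g ^ wr_base w x) (to x (wr_top w)).
Proof.
case: w => f h; rewrite {1}wr_decomp conjgM /=.
have -> : single g x ^ wr_in_base to f = single (g ^ f x) x.
  rewrite !conjgE -wr_in_base_inv -!wr_in_baseM.
  congr wr_in_base; apply: ds_ext => y; rewrite !dsME dsVE !ds_singleE.
  by case: eqP => [->|_] //; rewrite mul1g mulVg.
by rewrite conjgE mulgA wr_conj.
Qed.

(** By induction on the support: an element of the direct sum is the product of
    its finitely many nontrivial coordinates. *)
Lemma base_of_singles (L : set W) :
  is_subgroup L -> (forall g x, L (single g x)) -> forall f, L (wr_in_base to f).
Proof.
move=> sL Ls f; have [n] := ubnP #|` finsupp f|.
elim: n f => // n IHn f lt_f_n.
have [f0|[x xf]] := fset_0Vmem (finsupp f).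
  suff -> : f = 1 by exact: (subgroup1 sL).
  by apply: ds_ext => x; rewrite ds1E ds_dflt // f0 inE.
pose f' : direct_sum X G := (ds_single (f x) x)^-1 * f.
have -> : f = ds_single (f x) x * f' by rewrite mulVKg.
rewrite wr_in_baseM; apply: (subgroupM sL _ _ (Ls _ _)); apply: IHn.
have -> : finsupp f' = (finsupp f `\ x)%fset.
  apply/fsetP => y; rewrite !inE !mem_finsupp dsME dsVE ds_singleE.
  case: (eqVneq y x) => [->|_]; first by rewrite mulVg eqxx.
  by rewrite invg1 mul1g.
by move: lt_f_n; rewrite (cardfsD1 x) xf.
Qed.

Section Invariable.
Context (S : set G) (T : set H) (C : set X) (L : set W).
Hypothesis sL : is_subgroup L.
Hypothesis meetL : forall w, wreath_gens S T C w -> exists c, L (w ^ c).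

Lemma top_onto :
  invariably_generates T -> forall h, exists2 l, L l & wr_top l = h.
Proof.
move=> igT; apply: (invariably_generates_meet T _ igT).
  apply/is_subgroupP; split; first by exists 1 => //; exact: (subgroup1 sL).
  move=> _ _ [v Lv <-] [w Lw <-]; exists (v * w^-1) => //.
  exact: (subgroupM sL _ _ Lv (subgroupV sL _ Lw)).
move=> t Tt; have [|c Lc] := meetL (wr_in_top G to t).
  by right; exists t.
by exists (wr_top c), (wr_in_top G to t ^ c).
Qed.

Lemma fiber_on_transversal :
  invariably_generates S -> invariably_generates T ->
  forall x, C x -> forall g, L (single g x).
Proof.
move=> igS igT x Cx; apply: (invariably_generates_meet S _ igS).
  apply/is_subgroupP; split; first by rewrite single1; exact: (subgroup1 sL).
  move=> g k Lg Lk; rewrite singleM singleV.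
  exact: (subgroupM sL _ _ Lg (subgroupV sL _ Lk)).
move=> s Ss; have [|c Lc] := meetL (single s x); first by left; exists (s, x).
have [l Ll top_l] := top_onto igT (wr_top c)^-1.
exists (wr_base c x * wr_base l (to x (wr_top c))).
have := subgroupJ sL _ _ Lc Ll.
by rewrite !single_conj top_l actK -conjgM.
Qed.

Lemma meet_wreath_gens_full :
  invariably_generates S -> invariably_generates T -> meets_orbits C ->
  forall w, L w.
Proof.
move=> igS igT meetC w.
have Ls g y : L (single g y).
  have [x [Cx [h <-]]] := meetC y; have [l Ll top_l] := top_onto igT h.
  have := fiber_on_transversal igS igT x Cx (g ^ (wr_base l x)^-1).
  by move=> /(subgroupJ sL)/(_ Ll); rewrite single_conj top_l conjgKV.
have [l Ll top_l] := top_onto igT (wr_top w).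
rewrite -[w](mulgVK l); apply: (subgroupM sL _ _ _ Ll).
(* [w l^-1] has trivial top component, hence lies in the base group. *)
have -> : w * l^-1 = wr_in_base to (wr_base (w * l^-1)).
  rewrite /wr_in_base -(mulgV (wr_top w)) -{2}top_l -wr_topV -wr_topM.
  by case: (w * _).
exact: base_of_singles.
Qed.

End Invariable.

Lemma wreath_gens_invariable S T C :
  invariably_generates S -> invariably_generates T -> meets_orbits C ->
  invariably_generates (wreath_gens S T C).
Proof.
move=> igS igT meetC a; apply/seteqP; split=> // w _.
apply: (meet_wreath_gens_full S T C) => //; first exact: generated_subgroup.
by move=> v Sv; exists (a v); apply: sub_generated; exists v.
Qed.

Lemma wreath_FIG C :
  FIG G -> FIG H -> finite_set C -> meets_orbits C -> FIG W.
Proof.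
move=> [S [finS igS]] [T [finT igT]] finC meetC; exists (wreath_gens S T C).
by split; [exact: wreath_gens_finite | exact: wreath_gens_invariable].
Qed.

(** * Finitely generated wreath products have finitely many orbits *)

Lemma orbits_of_act C h y : orbits_of C (to y h) -> orbits_of C y.
Proof.
move=> [x [Cx [k xk]]]; exists x; split=> //; exists (k * h^-1).
by rewrite actM xk actK.
Qed.

(** The union of the orbits of [C] being [H]-invariant, base components supported
    on it are stable under the twist in the multiplication of the wreath
    product. *)
Lemma supported_subgroup (C : set X) :
  is_subgroup [set w : W | forall y, ~ orbits_of C y -> wr_base w y = 1].
Proof.
apply/is_subgroupP; split=> [y _|v w suppv suppw y nCy]; first exact: ds1E.
rewrite /= dsME ds_shiftE ds_shiftE dsVE suppv // suppw ?invg1 ?mulg1 //.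
by move=> /orbits_of_act/orbits_of_act.
Qed.

Lemma fin_gen_transversal :
  nontrivial_group G -> finitely_generated W ->
  exists2 C, finite_set C & meets_orbits C.
Proof.
move=> [g g1] [F [finF genF]].
pose C := \bigcup_(w in F) [set` finsupp (wr_base w)].
exists C; first by apply: bigcup_finite => // w _; exact: finite_fset.
move=> y; apply: contrapT => nCy.
(* A nontrivial element of the copy of [G] at [y] would lie in the subgroup of
   elements supported on the orbits of [C], which miss [y]. *)
suff : single g y \in [set w : W | forall z, ~ orbits_of C z -> wr_base w z = 1].
  by move/set_mem/(_ y nCy); rewrite /= ds_singleE eqxx.
apply/mem_set; apply: generates_sub genF (supported_subgroup C) _ _ => w Fw z nCz.
apply: ds_dflt; apply/negP => zw; apply: nCz.
exists z; split; first by exists w.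
by exists 1; rewrite act1.
Qed.

End WreathGeneration.

Theorem proposition2p6 (G H : groupType)
    (ntG : nontrivial_group G) (ntH : nontrivial_group H)
    (figG : FIG G) (figH : FIG H) :
  (forall (X : choiceType) (to : right_action H X), faithful_action to ->
     (FIG (wreath G to) \/ IG (wreath G to)) /\
     (FIG (wreath G to) <-> finitely_generated (wreath G to))) /\
  FIG (regular_wreath G H).
Proof.
split=> [X to _|].
  split; last first.
    split; first exact: FIG_finitely_generated.
    by move=> /(fin_gen_transversal to ntG)[C]; exact: wreath_FIG.
  have [|nFIG] := pselect (FIG (wreath G to)); [by left | right; split=> //].
  have [[S [_ igS]] [T [_ igT]]] := (figG, figH).
  exists (wreath_gens to S T setT); apply: wreath_gens_invariable => // y.
  by exists y; split=> //; exists 1; rewrite act1.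
(* In the regular action the identity represents the only orbit. *)
apply: (wreath_FIG _ [set 1]) => // y.
by exists 1; split=> //; exists y; rewrite /= mul1g.
Qed.
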